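(* Let $G$ be a finitely generated solvable group of derived length $k$ with $\mathrm{rank}_{\mathbb{Z}}\,G^{(k-1)}\ge d$. Then for every $1<p<d$, $\overline{H}^1(G,\lambda_{\ell^pG})=0$.
   Context: The derived series is $G^{(0)}=G$, $G^{(i+1)}=[G^{(i)},G^{(i)}]$; the derived length of a solvable group is the smallest $k$ with $G^{(k)}$ trivial. $\mathrm{rank}_{\mathbb{Z}}$ of the abelian group $G^{(k-1)}$ being at least $d$ (an integer) means that it contains a subgroup isomorphic to $\mathbb{Z}^d$. $\lambda_{\ell^pG}$ is the left-regular representation of $G$ on $\ell^pG$. A cocycle is a map $b:G\to\ell^pG$ with $b(gh)=b(g)+\lambda_{\ell^pG}(g)b(h)$; coboundaries are the cocycles $g\mapsto\lambda_{\ell^pG}(g)\xi-\xi$; $\overline{H}^1$ is the quotient of the space of cocycles by the closure (for pointwise convergence on $G$) of the space of coboundaries. *)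

(* Defs.v *)
From mathcomp Require Import all_boot all_order all_algebra.
From mathcomp Require Import all_classical all_reals all_analysis.
From mathcomp Require Import complex.

Set Implicit Arguments.
Unset Strict Implicit.
Unset Printing Implicit Defensive.
Import Order.TTheory GRing.Theory Num.Theory.

Local Open Scope classical_set_scope.
Local Open Scope ring_scope.

Section Groups.
Variable G : groupType.
Implicit Types A B : set G.

Definition is_subgroup A : Prop := group_closed [in A].

Definition generated A : set G := smallest is_subgroup A.

Definition finitely_generated : Prop :=
  exists s : seq G, generated [set` s] = setT.

Definition commutator_subgroup A B : set G :=
  generated [set commg x y | x in A & y in B].

Fixpoint derived_series (n : nat) : set G :=
  if n is m.+1 then
    commutator_subgroup (derived_series m) (derived_series m)
  else setT.

Definition solvable_of_length (k : nat) : Prop :=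
  derived_series k = [set 1%g] /\
  forall j, (j < k)%N -> derived_series j <> [set 1%g].

(* The image of [f] is the subgroup isomorphic to Z^d; Z^d is written
   additively and G multiplicatively. *)
Definition rankZ_ge (A : set G) (d : nat) : Prop :=
  exists f : 'rV[int]_d -> G,
    [/\ {morph f : u v / u + v >-> (u * v)%g}, injective f & range f `<=` A].

End Groups.

Arguments derived_series : clear implicits.
Arguments solvable_of_length : clear implicits.

(* [nrm] is the absolute value of the scalars [K], with values in [R]. It is a
   parameter because the norm of the type [R[i]] takes its values in [R[i]]. *)
Section ReducedCohomology.
Variables (R : realType) (K : zmodType) (nrm : K -> R).
Variables (G : groupType) (p : R).
Implicit Types (xi : G -> K) (b c : G -> G -> K).

Definition lp_norm xi : \bar R :=
  ((\esum_(x in [set: G]) (nrm (xi x) `^ p)%:E) `^ p^-1)%E.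

Definition in_lp xi : Prop := (lp_norm xi < +oo)%E.

Definition left_regular (g : G) xi : G -> K := fun x => xi (g^-1 * x)%g.

Definition cocycles : set (G -> G -> K) :=
  [set b | (forall g, in_lp (b g)) /\
           (forall g h, b (g * h)%g = b g + left_regular g (b h))].

Definition coboundaries : set (G -> G -> K) :=
  [set (fun g => left_regular g xi - xi) | xi in in_lp].

(* Closure in the space of cocycles, for the topology of pointwise convergence
   on G in the norm of l^p; the neighbourhoods of [b] are given by finitely
   many points of G and a radius. *)
Definition coboundaries_closure : set (G -> G -> K) :=
  [set b | cocycles b /\
    forall (s : seq G) (e : R), 0 < e ->
      exists2 c, coboundaries c &
        {in s, forall g, (lp_norm (b g - c g)%R < e%:E)%E}].

(* The quotient of the space of cocycles, as the set of cosets. *)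
Definition reduced_H1 : set (set (G -> G -> K)) :=
  [set [set b + c | c in coboundaries_closure] | b in cocycles].

Definition reduced_H1_eq0 : Prop := reduced_H1 = [set coboundaries_closure].

End ReducedCohomology.

(* The scalars of l^p are either the reals or the complex numbers. *)
Definition real_reduced_H1_eq0 (R : realType) (G : groupType) (p : R) : Prop :=
  reduced_H1_eq0 (@Num.norm R R) G p.

Definition complex_reduced_H1_eq0 (R : realType) (G : groupType) (p : R) : Prop :=
  reduced_H1_eq0 (@ComplexField.Normc.normc R) G p.

(* Main.v *)
Require Import Defs.
From mathcomp Require Import all_boot all_order all_algebra.
From mathcomp Require Import all_classical all_reals all_analysis.
From mathcomp Require Import finmap complex lra ring.

(** Write a cocycle as [b g x = f (g^-1 x) - f x] and let [beta] embed Z^d in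
    the abelian normal subgroup [A], the last nontrivial term of the derived
    series. Averaging [f] over the boxes [beta ([0, 2^n)^d) x] changes it, from
    one scale to the next, by [O((2 * 2^(-d/p))^n)] uniformly in [x]; as
    [p < d], the averages converge uniformly to an [A]-invariant function [c]
    with [f - c] tending to 0 at infinity. For each [g], the function
    [c (g x) - c x] is [A]-invariant (because [A] is normal) and tends to 0 at
    infinity, hence vanishes because [A] is infinite: [c] is constant. Finally,
    truncating [f - c] at a small height [t] gives a function whose coboundary is
    dominated by [b] and by [2 t], hence small in l^p, while [f - c] minus its
    truncation has finite support. *)

Set Implicit Arguments.
Unset Strict Implicit.
Unset Printing Implicit Defensive.
Import Order.TTheory GRing.Theory Num.Theory.
Import numFieldNormedType.Exports.

Local Open Scope classical_set_scope.
Local Open Scope ring_scope.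

(** * Summability of p-th powers and functions vanishing at infinity *)

Section SummablePowers.
Variables (R : realType) (T : choiceType) (p : R).
Hypothesis p_gt0 : 0 < p.
Implicit Types (u v : T -> R) (S : R) (s : seq T).

(** Bounding finite sums by a real [S], which controls the [p]-th power of the norm, keeps the
    estimates in [R] and away from extended reals. *)
Definition psum_le u S : Prop :=
  forall s, uniq s -> \sum_(x <- s) `|u x| `^ p <= S.

Lemma psum_le_ge0 u S : psum_le u S -> 0 <= S.
Proof. by move=> /(_ [::] isT); rewrite big_nil. Qed.

Lemma ler_powRl (a b : R) : 0 <= a -> a <= b -> a `^ p <= b `^ p.
Proof.
move=> a0 ab; apply: ge0_ler_powR; rewrite ?nnegrE//; first exact: ltW.
exact: le_trans ab.
Qed.

Lemma ler_psum u v S :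
  (forall x, `|v x| <= `|u x|) -> psum_le u S -> psum_le v S.
Proof.
move=> vu uS s us; apply: le_trans (uS s us).
by apply: ler_sum => x _; exact: ler_powRl.
Qed.

(** Bounding [a + b] by twice the larger term avoids convexity; the constant need not be sharp. *)
Lemma powRD_le (a b : R) : 0 <= a -> 0 <= b ->
  (a + b) `^ p <= 2 `^ p * (a `^ p + b `^ p).
Proof.
wlog ab : a b / a <= b => [hw a0 b0|a0 b0].
  have [/hw|/ltW/hw] := leP a b; first exact.
  by rewrite addrC [X in _ * X]addrC; exact.
apply: (@le_trans _ _ ((2 * b) `^ p)).
  by apply: ler_powRl; lra.
by rewrite powRM// ler_wpM2l ?powR_ge0// lerDr powR_ge0.
Qed.

Lemma psum_leD u v w S S' : (forall x, `|w x| <= `|u x| + `|v x|) ->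
  psum_le u S -> psum_le v S' -> psum_le w (2 `^ p * (S + S')).
Proof.
move=> wuv uS vS' s us.
apply: (@le_trans _ _ (2 `^ p * (\sum_(x <- s) `|u x| `^ p +
                                 \sum_(x <- s) `|v x| `^ p))); last first.
  by rewrite ler_wpM2l ?powR_ge0// lerD ?uS ?vS'.
rewrite -big_split/= mulr_sumr; apply: ler_sum => x _.
by apply: le_trans (powRD_le _ _) => //; exact: ler_powRl.
Qed.

Lemma psum_le_finite u F : uniq F -> (forall x, x \notin F -> u x = 0) ->
  psum_le u (\sum_(x <- F) `|u x| `^ p).
Proof.
move=> uF u0 s us; rewrite (bigID (mem F))/= [X in _ + X]big1 ?addr0; last first.
  by move=> x /u0 ->; rewrite normr0 powR0// gt_eqF.
rewrite -big_filter (perm_big [seq x <- F | x \in s]); last first.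
  by apply: uniq_perm; rewrite ?filter_uniq// => x; rewrite !mem_filter andbC.
rewrite big_filter [leRHS](bigID (mem s))/= lerDl.
by apply: sumr_ge0 => x _; exact: powR_ge0.
Qed.

(* The finite set [F] carries the l^p mass of [h] up to [e / 2], and [t] is so
   small that [F] contributes at most [e / 2] to the mass of [w]. *)
Lemma psum_le_dominated h S (e : R) : 0 < e -> psum_le h S ->
  exists2 t, 0 < t & forall w, (forall x, `|w x| <= `|h x|) ->
    (forall x, `|w x| <= t) -> psum_le w e.
Proof.
move=> e0 hS.
pose E := [set \sum_(x <- s) `|h x| `^ p | s in [set s | uniq s]].
have supE : has_sup E.
  split; first by exists (\sum_(x <- [::]) `|h x| `^ p), [::].
  by exists S => _ [s us <-]; exact: hS.
have e20 : 0 < e / 2 by lra.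
have [_ [F uF <-] supF] := sup_adherent e20 supE.
(* The successor keeps the divisor positive when [F] is empty. *)
pose n : R := (size F).+1%:R; have n0 : 0 < n by rewrite ltr0n.
exists ((e / 2 / n) `^ p^-1); first by apply/powR_gt0/divr_gt0.
move=> w wh wt s us; rewrite (bigID (mem F))/=.
have -> : e = e / 2 + e / 2 by lra.
apply: lerD.
- apply: (@le_trans _ _ (\sum_(x <- [seq x <- s | x \in F]) (e / 2 / n))).
    rewrite big_filter; apply: ler_sum => x _.
    apply: (@le_trans _ _ (((e / 2 / n) `^ p^-1) `^ p)); first exact: ler_powRl.
    by rewrite -powRrM mulVf ?gt_eqF// powRr1// ltW// divr_gt0.
  rewrite big_const_seq count_predT iter_addr_0 -[_ *+ _]mulr_natr mulrAC.
  rewrite ler_pdivrMr// ler_pM2l// ler_nat.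
  apply: leqW; apply: uniq_leq_size; first exact: filter_uniq.
  by move=> x; rewrite mem_filter => /andP[].
- pose s' := [seq x <- s | x \notin F].
  have us' : uniq (F ++ s').
    rewrite cat_uniq uF filter_uniq// andbT; apply/hasPn => x.
    by rewrite mem_filter => /andP[].
  have : \sum_(x <- F ++ s') `|h x| `^ p <= sup E.
    by apply: ub_le_sup; [exact: supE.2 | exists (F ++ s')].
  rewrite big_cat/= => le_sup.
  have : \sum_(x <- s') `|h x| `^ p <= e / 2 by lra.
  apply: le_trans; rewrite big_filter; apply: ler_sum => x _.
  exact: ler_powRl.
Qed.

(** Convergence to 0 at infinity on the discrete set [T]. *)
Definition c0 (u : T -> R) : Prop := forall e, 0 < e -> finite_set [set x | e <= `|u x|].

Lemma psum_c0 u S : psum_le u S -> c0 u.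
Proof.
move=> uS e e0; apply: contrapT => /infinite_set_fset.
have ep0 : 0 < e `^ p by rewrite powR_gt0.
have S0 := psum_le_ge0 uS.
(* Chebyshev: more than [S / e ^ p] points, each contributing at least [e ^ p], would exceed [S]. *)
move=> /(_ (Num.truncn (S / e `^ p)).+1)[B Be cB].
have /(_ _ (fset_uniq B)) := uS; apply/negP; rewrite -ltNge.
apply: (@lt_le_trans _ _ (\sum_(x <- B) e `^ p)); last first.
  rewrite !big_seq; apply: ler_sum => x /Be/= ex.
  by apply: ler_powRl => //; exact: ltW.
rewrite big_const_seq count_predT iter_addr_0 -mulr_natr mulrC -ltr_pdivrMr//.
apply: lt_le_trans (truncnS_gt _) _; by rewrite ler_nat.
Qed.

Lemma c0D u v : c0 u -> c0 v -> c0 (u \+ v).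
Proof.
move=> u0 v0 e e0; have e20 : 0 < e / 2 by lra.
apply: sub_finite_set (_ : _ `<=` [set x | e / 2 <= `|u x|] `|`
  [set x | e / 2 <= `|v x|]) _; last by rewrite finite_setU; split; [exact: u0|exact: v0].
move=> x /= exy; have := ler_normD (u x) (v x).
by case: (leP (e / 2) `|u x|) => h1 h2; [left|right => /=; lra].
Qed.

Lemma c0N u : c0 u -> c0 (\- u).
Proof. by move=> u0 e /u0; under eq_set do rewrite -normrN. Qed.

Lemma c0Z (a : R) u : c0 u -> c0 (fun x => a * u x).
Proof.
move=> u0 e e0; have [->|a0] := eqVneq a 0.
  rewrite (_ : [set _ | _] = set0)//; apply/seteqP; split => x //=.
  by rewrite mul0r normr0; lra.
have a1 : 0 < `|a| by rewrite normr_gt0.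
by have := u0 _ (divr_gt0 e0 a1); under eq_set do rewrite ler_pdivrMr// mulrC -normrM.
Qed.

Lemma c0_sum (I : Type) (r : seq I) (F : I -> T -> R) :
  (forall i, c0 (F i)) -> c0 (fun x => \sum_(i <- r) F i x).
Proof.
move=> F0; elim: r => [e e0|i r IH].
  rewrite (_ : [set _ | _] = set0)//; apply/seteqP; split => x //=.
  by rewrite big_nil normr0; lra.
have := c0D (F0 i) IH; congr c0; apply/funext => x.
by rewrite big_cons.
Qed.

Lemma c0_unif u : (forall e, 0 < e -> exists2 v, c0 v & forall x, `|u x - v x| <= e) ->
  c0 u.
Proof.
move=> h e e0; have e20 : 0 < e / 2 by lra.
have [v /(_ _ e20) v0 uv] := h _ e20.
apply: sub_finite_set v0 => x /= eu.
have := ler_normB (u x - v x) (- v x); have := uv x.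
rewrite opprK subrK normrN; lra.
Qed.

End SummablePowers.

(** * The l^p norm expressed through finite sums *)

Section LpNorm.
Variables (R : realType) (K : zmodType) (nrm : K -> R) (G : groupType) (p : R).
Hypotheses (p_gt0 : 0 < p) (nrm_ge0 : forall a, 0 <= nrm a).
Implicit Types xi : G -> K.

Lemma esum_powR_le xi S : psum_le p (nrm \o xi) S ->
  (\esum_(x in [set: G]) (nrm (xi x) `^ p)%:E <= S%:E)%E.
Proof.
move=> xiS; apply: ge_ereal_sup => _ [A [finA _] <-].
rewrite fsbig_finite//= sumEFin lee_fin; apply: le_trans (xiS _ (fset_uniq _)).
by under [leRHS]eq_bigr do rewrite /= ger0_norm//.
Qed.

Lemma in_lpP xi : in_lp nrm p xi <-> exists S, psum_le p (nrm \o xi) S.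
Proof.
rewrite /in_lp /lp_norm; split => [/lty_poweRy|[S xiS]]; last first.
  apply: poweR_lty; apply: le_lt_trans (esum_powR_le xiS) _; exact: ltry.
rewrite invr_eq0 gt_eqF// => /(_ isT) fin.
exists (fine (\esum_(x in [set: G]) (nrm (xi x) `^ p)%:E)) => s us.
rewrite -lee_fin fineK; last first.
  by rewrite ge0_fin_numE// esum_ge0// => x _; rewrite lee_fin powR_ge0.
apply: esum_ge; exists [set` s]; first by split.
rewrite -fsbig_seq// sumEFin lee_fin.
by under eq_bigr do rewrite /= ger0_norm//.
Qed.

(** Finite sums give only a weak bound on the norm; halving [e] makes it strict. *)
Lemma lp_norm_lt xi (e : R) : 0 < e ->
  psum_le p (nrm \o xi) ((e / 2) `^ p) -> (lp_norm nrm p xi < e%:E)%E.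
Proof.
move=> e0 /esum_powR_le xie; rewrite /lp_norm.
apply: (@le_lt_trans _ _ ((((e / 2) `^ p)%:E `^ p^-1)%E)).
  apply: gt0_ler_poweR => //; first by rewrite invr_ge0 ltW.
  - rewrite in_itv/= leey andbT; apply: esum_ge0 => x _.
    by rewrite lee_fin powR_ge0.
  - by rewrite in_itv/= leey andbT lee_fin powR_ge0.
rewrite poweR_EFin -powRrM mulfV ?gt_eqF// powRr1; last lra.
rewrite lte_fin; lra.
Qed.

End LpNorm.

(** * Geometric convergence of real sequences *)

Section RealSequences.
Variable R : realType.

Lemma expr_small (C r e : R) : 0 <= r < 1 -> 0 < e -> exists n, C * r ^+ n <= e.
Proof.
move=> /andP[r0 r1] e0.
(* [C] may be zero or negative, so a positive majorant serves as divisor. *)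
have C0 : 0 < `|C| + 1 by rewrite ltr_wpDl.
have : (r ^+ n) @[n --> \oo] --> (0 : R) by apply: cvg_expr; rewrite ger0_norm.
move=> /cvgr0Pnorm_lt /(_ _ (divr_gt0 e0 C0))[n _ /(_ n (leqnn n))].
rewrite /= ger0_norm ?exprn_ge0// ltr_pdivlMr// mulrC => /ltW rn.
exists n; apply: le_trans rn; rewrite ler_wpM2r ?exprn_ge0//.
by rewrite (le_trans (ler_norm _))// lerDl.
Qed.

(** The intervals centred at [u n] of radius [D * r ^+ n], the sum of the geometric tail, are
    nested; the supremum of their left ends lies in all of them. *)
Lemma geometric_limit (u : nat -> R) (C r : R) : 0 <= r < 1 ->
  (forall n, `|u n - u n.+1| <= C * r ^+ n) ->
  exists c, forall n, `|u n - c| <= C / (1 - r) * r ^+ n.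
Proof.
move=> /andP[r0 r1] uC; have r10 : 0 < 1 - r by rewrite subr_gt0.
set D := C / (1 - r).
have DE : D * (1 - r) = C by rewrite /D divfK ?gt_eqF.
have step n : D * r ^+ n.+1 + C * r ^+ n = D * r ^+ n.
  by rewrite -DE exprS; ring.
pose lo n := u n - D * r ^+ n; pose hi n := u n + D * r ^+ n.
have lo_hi n : lo n <= hi n.
  rewrite /lo /hi -subr_ge0.
  have : 0 <= C * r ^+ n by apply: le_trans (uC n).
  rewrite -DE mulrAC pmulr_lge0//; lra.
have lo_nd : {homo lo : m n / (m <= n)%N >-> m <= n}.
  apply: homo_leq => [//|y x z|n]; first exact: le_trans.
  have := uC n; rewrite ler_norml => /andP[_]; have := step n; rewrite /lo; lra.
have hi_ni : {homo hi : m n / (m <= n)%N >-> n <= m}.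
  apply: (@homo_leq _ hi (fun x y => y <= x)) => [//|y x z xy yz|n].
    exact: le_trans xy.
  have := uC n; rewrite ler_norml => /andP[+ _]; have := step n; rewrite /hi; lra.
have lohi m n : lo m <= hi n.
  have [mn|/ltnW nm] := leqP m n.
    exact: le_trans (lo_nd _ _ mn) (lo_hi n).
  exact: le_trans (lo_hi m) (hi_ni _ _ nm).
exists (sup (range lo)) => n.
have : sup (range lo) <= hi n.
  by apply: ge_sup => [|_ [m _ <-]]; [exists (lo 0), 0 | exact: lohi].
have : lo n <= sup (range lo).
  apply: ub_le_sup; last by exists n.
  by exists (hi 0) => _ [m _ <-]; exact: lohi.
rewrite /lo /hi ler_norml; lra.
Qed.

End RealSequences.

(** * Averages of a function over finite sets of left translates *)

Section Averages.
Variables (R : realType) (G : groupType).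
Implicit Types (L : seq G) (u : G -> R).

Lemma c0_translate (g : G) u : c0 u -> c0 (fun x => u (g * x)%g).
Proof.
by move=> u0 e /u0; apply: finite_preimage => x y _ _; exact: mulgI.
Qed.

Definition average L u (x : G) : R := (\sum_(a <- L) u (a * x)%g) / (size L)%:R.

Lemma averageC L L' u x : {in L & L', forall a b : G, (a * b = b * a)%g} ->
  average L (average L' u) x = average L' (average L u) x.
Proof.
move=> LL'; rewrite /average -!mulr_suml exchange_big/= mulrAC.
congr (_ * _); congr (_ * _); rewrite [LHS]big_seq [RHS]big_seq; apply: eq_bigr => b bL'.
rewrite [LHS]big_seq [RHS]big_seq; apply: eq_bigr => a aL.
by rewrite !mulgA (LL' a b).
Qed.

(** Commutation lets the shift by [a] pass inside the average, where it meets an increment of [u];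
    for the functions of interest that increment is p-summable. *)
Lemma average_shift L u a x : {in L, forall b : G, (a * b = b * a)%g} ->
  average L u (a * x)%g - average L u x =
  average L (fun y => u (a * y)%g - u y) x.
Proof.
move=> La; rewrite /average -mulrBl; congr (_ / _).
rewrite -sumrB [LHS]big_seq [RHS]big_seq; apply: eq_bigr => b bL.
by rewrite !mulgA (La b).
Qed.

Lemma average_sub L u x : (0 < size L)%N ->
  average L u x - u x = average L (fun y => u y - u x) x.
Proof.
move=> L0; rewrite /average sumrB mulrBl; congr (_ - _).
by rewrite big_const_seq count_predT iter_addr_0 -[_ *+ _]mulr_natr mulfK// pnatr_eq0 -lt0n.
Qed.

Lemma average_osc L u (k : R) x : (0 < size L)%N ->
  {in L, forall a : G, `|u (a * x)%g - u x| <= k} -> `|average L u x - u x| <= k.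
Proof.
move=> L0 uk; rewrite average_sub// /average normrM normfV normr_nat.
rewrite ler_pdivrMr ?ltr0n//; apply: le_trans (ler_norm_sum _ _ _) _.
rewrite big_seq; apply: le_trans (ler_sum _ uk) _.
by rewrite -big_seq big_const_seq count_predT iter_addr_0 mulr_natr.
Qed.

(* The bound comes from [|y| <= delta + |y|^p / delta^(p-1)], summed over [L]. *)
Lemma average_le (p : R) L u S (delta : R) x : 1 < p -> uniq L -> 0 < delta ->
  delta `^ p * (size L)%:R = 1 -> psum_le p u S ->
  `|average L u x| <= (1 + S) * delta.
Proof.
move=> p1 uL d0 dL uS.
have L0 : (0 : R) < (size L)%:R.
  rewrite lt_neqAle ler0n andbT eq_sym; apply/eqP => L0; move: dL.
  by rewrite L0 mulr0 => /esym/eqP; rewrite oner_eq0.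
have dp0 : 0 < delta `^ (p - 1) by rewrite powR_gt0.
have young y : `|y| <= delta + `|y| `^ p / delta `^ (p - 1).
  have [yd|/ltW yd] := leP `|y| delta.
    by rewrite (le_trans yd)// lerDl divr_ge0// powR_ge0.
  have y_p : `|y| <= `|y| `^ p / delta `^ (p - 1).
    rewrite ler_pdivlMr// -(@mulr_powRB1 _ `|y| p)//; last lra.
    rewrite ler_wpM2l//; apply: ge0_ler_powR; rewrite ?nnegrE//; lra.
  by apply: le_trans y_p _; rewrite lerDr ltW.
rewrite /average normrM normfV normr_nat ler_pdivrMr//.
apply: le_trans (ler_norm_sum _ _ _) _.
apply: (@le_trans _ _ (\sum_(a <- L) (delta + `|u (a * x)%g| `^ p / delta `^ (p - 1)))).
  by apply: ler_sum => a _; exact: young.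
rewrite big_split/= big_const_seq count_predT iter_addr_0 -mulr_suml.
(* Right translation by [x] is injective, so the summation points are distinct and [S] bounds the
   sum. *)
have := uS [seq a * x | a <- L]%g.
rewrite (map_inj_uniq (mulIg x)) big_map => /(_ uL) uSx.
rewrite mulrDl mul1r mulrDl -[delta *+ _]mulr_natr lerD2l.
rewrite ler_pdivrMr//; apply: le_trans uSx _.
(* The normalisation of [delta] reads [delta * delta ^ (p - 1) * size L = 1]. *)
suff -> : S * delta * (size L)%:R * delta `^ (p - 1) = S by [].
rewrite -(@mulr_powRB1 _ delta p) ?(ltW d0)// in dL; last lra.
by transitivity (S * (delta * delta `^ (p - 1) * (size L)%:R)); [ring | rewrite dL mulr1].
Qed.

End Averages.

(** * Averages over dyadic boxes in the copy of Z^d *)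

Section Boxes.
Variables (R : realType) (G : groupType) (d : nat) (beta : 'rV[int]_d -> G).
Hypotheses (betaD : {morph beta : v w / v + w >-> (v * w)%g})
  (beta_inj : injective beta).
Implicit Types (u : G -> R) (k : R).

Definition box (n : nat) : seq G :=
  [seq beta (\row_i (v i)%:Z) | v : {ffun 'I_d -> 'I_(2 ^ n)}].

Lemma size_box n : size (box n) = (2 ^ (n * d))%N.
Proof. by rewrite /box size_map -cardE card_ffun !card_ord expnM. Qed.

Lemma size_box_gt0 n : (0 < size (box n))%N.
Proof. by rewrite size_box expn_gt0. Qed.

Lemma box_uniq n : uniq (box n).
Proof.
rewrite map_inj_uniq ?enum_uniq// => v w /beta_inj /rowP vw.
by apply/ffunP => i; have := vw i; rewrite !mxE => -[/val_inj].
Qed.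

(** Any box element is reached from the identity by at most [d * 2 ^ n] unit coordinate steps, each
    costing at most [k]. *)
Lemma box_osc u k n :
  (forall i x, `|u (beta (delta_mx ord0 i) * x)%g - u x| <= k) ->
  {in box n, forall a x, `|u (a * x)%g - u x| <= d%:R * 2 ^+ n * k}.
Proof.
move=> uk _ /mapP[v _ ->].
pose P v c := forall x, `|u (beta v * x)%g - u x| <= c.
have beta0 : beta 0 = 1%g.
  by apply: (mulgI (beta 0)); rewrite -betaD addr0 mulg1.
have P0 : P 0 0 by move=> x; rewrite beta0 mul1g subrr normr0.
have PD w c w' c' : P w c -> P w' c' -> P (w + w') (c + c').
  move=> Pw Pw' x; rewrite betaD -mulgA.
  apply: le_trans (lerD (Pw (beta w' * x)%g) (Pw' x)).
  by apply: le_trans (ler_normD _ _); rewrite addrA subrK.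
have PM w c m : P w c -> P (w *+ m) (c *+ m).
  move=> Pw; elim: m => [|m IH]; first by rewrite !mulr0n.
  by rewrite !mulrS; exact: PD.
(* For [d = 0] nothing forces [k] to be nonnegative, hence the index [i]. *)
have k_ge0 (i : 'I_d) : 0 <= k by apply: le_trans (uk i 1%g).
have -> : \row_i (v i)%:Z = \sum_i delta_mx ord0 i *+ v i.
  rewrite [LHS]row_sum_delta; apply: eq_bigr => i _.
  by rewrite mxE -natz scaler_nat.
have Pv : P (\sum_i delta_mx ord0 i *+ v i) (\sum_i k *+ v i).
  by apply: big_ind2 => // i _; apply: PM => x; exact: uk.
move=> x; apply: le_trans (Pv x) _.
have -> : d%:R * 2 ^+ n * k = \sum_(i < d) k *+ (2 ^ n).
  by rewrite sumr_const card_ord -natrX -[k *+ (2 ^ n)]mulr_natr -[_ *+ d]mulr_natr; ring.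
apply: ler_sum => i _.
by rewrite -[k *+ v i]mulr_natr -[k *+ (2 ^ n)]mulr_natr ler_wpM2l ?k_ge0// ler_nat ltnW.
Qed.

Lemma beta_comm v w : (beta v * beta w = beta w * beta v)%g.
Proof. by rewrite -!betaD addrC. Qed.

Variables (p : R) (f : G -> R).
Hypotheses (p_gt1 : 1 < p) (p_ltd : p < d%:R)
  (df_summable : forall g, exists S, psum_le p (fun x => f (g * x)%g - f x) S).

(** Chosen so that [rho ^+ n] is the [delta] that [average_le] requires for the box of [2 ^ (n * d)]
    elements. *)
Let rho : R := 2 `^ (- (d%:R / p)).

Let rho_gt0 : 0 < rho. Proof. by rewrite powR_gt0. Qed.

(* This is where p < d is used: moving a box of side [2^n] by its own size
   costs [2^n] steps, each of size [rho^n]. *)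
Let two_rho : 0 <= 2 * rho < 1.
Proof.
have p0 : 0 < p by apply: lt_trans p_gt1.
apply/andP; split; first by rewrite mulr_ge0// ltW.
rewrite /rho powRN ltr_pdivrMr ?powR_gt0// mul1r -[ltLHS]powRr1//.
by rewrite /powR !gt_eqF// ltr_expR ltr_pM2r ?ln_gt0 ?ltr1n// ltr_pdivlMr// mul1r.
Qed.

Let rho_box n : (rho ^+ n) `^ p * (size (box n))%:R = 1.
Proof.
have p0 : 0 < p by apply: lt_trans p_gt1.
have rho_p : rho `^ p = 2 ^- d.
  by rewrite /rho -powRrM mulNr divfK ?gt_eqF// powR_invn.
rewrite -powR_mulrn ?(ltW rho_gt0)// powRAC rho_p.
rewrite powR_mulrn ?invr_ge0 ?exprn_ge0// size_box natrX.
by rewrite exprVn -exprM mulnC mulVf// expf_neq0.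
Qed.

Let average_box_le g S n x : psum_le p (fun x => f (g * x)%g - f x) S ->
  `|average (box n) (fun y => f (g * y)%g - f y) x| <= (1 + S) * rho ^+ n.
Proof.
apply: (average_le _ p_gt1 (box_uniq n) _ (rho_box n)); exact: exprn_gt0.
Qed.

Let u n := average (box n) f.

(** Both [u n] and [u n.+1] are compared with the double average over [box n] and [box n.+1], which
    does not depend on the order of averaging. *)
Lemma average_box_cauchy : exists C, forall x n,
  `|u n x - u n.+1 x| <= C * (2 * rho) ^+ n.
Proof.
have [S fS] := choice (fun i => df_summable (beta (delta_mx ord0 i))).
pose M := \sum_i S i.
have S_ge0 i : 0 <= S i := psum_le_ge0 (fS i).
have SM i : S i <= M by rewrite /M (bigD1 i)//= lerDl sumr_ge0.
have M_ge0 : 0 <= M by exact: sumr_ge0.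
have u_step n i x :
    `|u n (beta (delta_mx ord0 i) * x)%g - u n x| <= (1 + M) * rho ^+ n.
  rewrite /u average_shift; last by move=> _ /mapP[v _ ->]; exact: beta_comm.
  apply: le_trans (average_box_le _ _ (fS i)) _.
  by apply: ler_wpM2r; [apply/exprn_ge0/ltW/rho_gt0 | rewrite lerD2l].
have swap n x : average (box n.+1) (u n) x = average (box n) (u n.+1) x.
  by apply: averageC => _ _ /mapP[v _ ->] /mapP[w _ ->]; exact: beta_comm.
(* Averaging [u n] over the larger box costs [2 * K]; averaging [u n.+1] over the smaller one costs
   [rho * K <= K]. *)
exists (3 * (d%:R * (1 + M))) => x n.
pose K := d%:R * (1 + M) * (2 * rho) ^+ n.
have /andP[_ rho1] := two_rho; have rho0 := rho_gt0.
have K0 : 0 <= K by rewrite !mulr_ge0 ?addr_ge0 ?exprn_ge0// mulr_ge0// ltW.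
have h1 : `|average (box n.+1) (u n) x - u n x| <= 2 * K.
  apply: average_osc (size_box_gt0 _) _ => a aL.
  apply: le_trans (box_osc (u_step n) aL x) _.
  by rewrite /K exprS exprMn le_eqVlt; apply/orP; left; apply/eqP; ring.
have h2 : `|average (box n) (u n.+1) x - u n.+1 x| <= rho * K.
  apply: average_osc (size_box_gt0 _) _ => a aL.
  apply: le_trans (box_osc (u_step n.+1) aL x) _.
  by rewrite /K exprS exprMn le_eqVlt; apply/orP; left; apply/eqP; ring.
have rhoK : rho * K <= K by rewrite ler_piMl//; lra.
rewrite -mulrA -/K; move: h1 h2; rewrite swap !ler_norml.
by move=> /andP[? ?] /andP[? ?]; apply/andP; split; lra.
Qed.

Variable A : set G.
Hypotheses (betaA : range beta `<=` A)
  (A_comm : forall a b, A a -> A b -> (a * b = b * a)%g)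
  (A_normal : forall g a, A a -> A (g * a * g^-1)%g).

(** For fixed [n], [f - u n] is a finite combination of increments of [f], hence vanishes at
    infinity, and this survives the uniform limit. Invariance holds under all of [A], not only the
    range of [beta], since every element of [A] commutes with the boxes. *)
Lemma average_box_limit : exists c : G -> R,
  c0 (f \- c) /\ forall a x, A a -> c (a * x)%g = c x.
Proof.
have [C uC] := average_box_cauchy.
have [c uc] := choice (fun x => geometric_limit two_rho (uC x)).
set D := C / (1 - 2 * rho) in uc.
exists c; split.
  apply: c0_unif => e e0; have [n De] := expr_small D two_rho e0.
  exists (f \- u n); last first.
    move=> x /=; rewrite opprB addrC addrA subrK.
    exact: le_trans (uc _ _) De.
  have : c0 (fun x => - (size (box n))%:R^-1 *
                      \sum_(a <- box n) (f (a * x)%g - f x)).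
    apply/c0Z/c0_sum => a; have [S fS] := df_summable a.
    by apply: psum_c0 fS; exact: lt_trans p_gt1.
  congr c0; apply/funext => x /=.
  rewrite -opprB average_sub ?size_box_gt0// /average; ring.
move=> a x Aa; have [S fS] := df_summable a.
apply/eqP; rewrite -subr_eq0 -normr_le0; apply/ler_addgt0Pl => e e0; rewrite addr0.
(* [2 * D] pays for replacing [c] by [u n] at [x] and at [a * x], and [1 + S] for shifting the
   average; [rho ^+ n] is enlarged to [(2 * rho) ^+ n] to have a single rate. *)
have [n le_e] := expr_small (2 * D + (1 + S)) two_rho e0.
apply: le_trans le_e; rewrite mulrDl.
have S0 := psum_le_ge0 fS.
have : (1 + S) * rho ^+ n <= (1 + S) * (2 * rho) ^+ n.
  apply: ler_wpM2l; first by rewrite addr_ge0.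
  by rewrite lerXn2r ?nnegrE ?mulr_ge0 ?ltW ?rho_gt0//; have := rho_gt0; lra.
have := average_box_le n x fS; rewrite -average_shift; last first.
  by move=> _ /mapP[v _ ->]; apply: A_comm => //; apply: betaA; exists (\row_i (v i)%:Z).
rewrite -/(u n); have := uc x n; have := uc (a * x)%g n.
rewrite !ler_norml => /andP[? ?] /andP[? ?] /andP[? ?] ?.
by apply/andP; split; lra.
Qed.

Lemma constant_at_infinity : exists c : R, c0 (fun x => f x - c).
Proof.
have [c [fc cA]] := average_box_limit.
have p0 : 0 < p by exact: lt_trans p_gt1.
have d0 : (0 < d)%N by rewrite -(ltr_nat R); exact: lt_trans p_ltd.
suff c_const g x : c (g * x)%g = c x.
  exists (c 1%g); congr c0: fc; apply/funext => x /=.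
  by rewrite -(c_const x 1%g) mulg1.
apply: contrapT => /eqP; rewrite -subr_eq0 -normr_gt0 => cgx.
have [S fS] := df_summable g.
have c0h : c0 (fun x => c (g * x)%g - c x).
  (* With [v = f - c], the function is [- v (g * x) + (f (g * x) - f x) + v x]. *)
  have := c0D (c0D (c0N (c0_translate g fc)) (psum_c0 p0 fS)) fc.
  by congr c0; apply/funext => y /=; ring.
have fin := c0h _ cgx.
(* Infinitely many points, as [d > 0], at which the increment of [c] keeps its nonzero value at [x]:
   this contradicts [fin]. *)
pose j (n : nat) := (beta (const_mx n%:Z) * x)%g.
have j_inj : injective j.
  move=> m n /mulIg/beta_inj/rowP/(_ (Ordinal d0)).
  by rewrite !mxE => -[].
apply: infinite_nat; apply: sub_finite_set (finite_preimage (in2W j_inj) fin).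
move=> n _ /=; rewrite /j; set b := beta _.
have Ab : A b by apply: betaA; exists (const_mx n%:Z).
rewrite (cA b x)//.
rewrite (_ : g * (b * x) = (g * b * g^-1) * (g * x))%g; last by rewrite !mulgA mulgVK.
by rewrite (cA (g * b * g^-1)%g)//; exact: A_normal.
Qed.



End Boxes.

(** * Truncation of real numbers to a symmetric interval *)

Section Truncation.
Variable R : realType.

Definition truncate (t y : R) : R := Num.max (- t) (Num.min t y).

(** This makes the coboundary of a truncated function pointwise dominated by the original one. *)
Lemma truncateB t y z : `|truncate t y - truncate t z| <= `|y - z|.
Proof.
rewrite /truncate !maxEle !minEle ler_norml.
have := ler_norm (y - z); have := ler_norm (z - y); rewrite distrC => ? ?.
by repeat case: ifP => [|/negbT]; rewrite -?ltNge => *; apply/andP; split; lra.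
Qed.

Lemma truncate_le t y : 0 <= t -> `|truncate t y| <= t.
Proof.
move=> t0; rewrite /truncate maxEle minEle ler_norml.
by repeat case: ifP => [|/negbT]; rewrite -?ltNge => *; apply/andP; split; lra.
Qed.

Lemma truncate_id t y : `|y| <= t -> truncate t y = y.
Proof.
rewrite ler_norml => /andP[ty yt].
by rewrite /truncate (min_idPr _)// (max_idPr _).
Qed.

End Truncation.

(** * Approximation of real cocycles by coboundaries *)

Section RealCocycle.
Variables (R : realType) (G : groupType) (d : nat) (beta : 'rV[int]_d -> G).
Variables (A : set G) (p : R).
Hypotheses (betaD : {morph beta : v w / v + w >-> (v * w)%g})
  (beta_inj : injective beta) (betaA : range beta `<=` A)
  (A_comm : forall a b, A a -> A b -> (a * b = b * a)%g)
  (A_normal : forall g a, A a -> A (g * a * g^-1)%g)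
  (p_gt1 : 1 < p) (p_ltd : p < d%:R).

(* A cocycle is the coboundary of the function [x |-> b x^-1 1], which need not
   be in l^p but tends to a constant [c] at infinity; cutting it off within
   distance [t / 2] of [c] changes the coboundary by little. *)
Lemma cocycle_approx (b : G -> G -> R) (s : seq G) (e : R) :
  (forall g, exists S, psum_le p (b g) S) ->
  (forall g h x, b (g * h)%g x = b g x + b h (g^-1 * x)%g) -> 0 < e ->
  exists xi : G -> R, (exists S, psum_le p xi S) /\
    {in s, forall g, psum_le p (fun x => b g x - (xi (g^-1 * x)%g - xi x)) e}.
Proof.
move=> b_lp bM e0; have p0 : 0 < p by exact: lt_trans p_gt1.
pose f x := b x^-1%g 1%g.
(* The cocycle identity for the product [x^-1 * g^-1], evaluated at 1. *)
have fE g x : f (g * x)%g - f x = b g^-1%g x.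
  by rewrite /f invgM bM invgK mulg1 addrC addKr.
have f_lp g : exists S, psum_le p (fun x => f (g * x)%g - f x) S.
  have [S bS] := b_lp g^-1%g; exists S.
  by apply: ler_psum bS => // x; rewrite fE.
have [c fc] := constant_at_infinity betaD beta_inj p_gt1 p_ltd f_lp betaA
  A_comm A_normal.
(* Induction on [s] gives one height for all its elements, the minimum of the individual ones. *)
have [t t0 small] : exists2 t, 0 < t & {in s, forall g (w : G -> R),
    (forall x, `|w x| <= `|b g x|) -> (forall x, `|w x| <= t) -> psum_le p w e}.
  elim: s => [|g s [t t0 IH]]; first by exists 1.
  have [S bS] := b_lp g; have [t' t'0 dom] := psum_le_dominated p0 e0 bS.
  exists (Num.min t t'); first by rewrite lt_min t0.
  move=> h; rewrite inE => /orP[/eqP->|hs] w wb wt.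
    by apply: dom => // x; apply: le_trans (wt x) _; rewrite ge_min lexx orbT.
  by apply: (IH h) => // x; apply: le_trans (wt x) _; rewrite ge_min lexx.
have t20 : 0 < t / 2 by rewrite divr_gt0.
pose u x := f x - c.
exists (fun x => u x - truncate (t / 2) (u x)); split.
  have ufin := fc _ t20.
  eexists; apply: (@psum_le_finite _ _ _ p0 _ (fset_set [set x | t / 2 <= `|u x|])).
    exact: fset_uniq.
  move=> x; rewrite in_fset_set// notin_setE/= => /negP; rewrite -ltNge => /ltW ux.
  by rewrite truncate_id// subrr.
move=> g gs.
(* Since [b g] is the increment of [u], the error is the increment of the truncation: a difference
   of two values of size at most [t / 2]. *)
have wE x : b g x - (u (g^-1 * x)%g - truncate (t / 2) (u (g^-1 * x)%g) -
    (u x - truncate (t / 2) (u x))) =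
    truncate (t / 2) (u (g^-1 * x)%g) - truncate (t / 2) (u x).
  by have := fE g^-1%g x; rewrite invgK => <-; rewrite /u; ring.
apply: (small g gs) => x; rewrite wE.
  apply: le_trans (truncateB _ _ _) _.
  by rewrite /u opprB addrA subrK fE invgK.
apply: le_trans (ler_normB _ _) _.
have := truncate_le (u (g^-1 * x)%g) (ltW t20).
have := truncate_le (u x) (ltW t20); lra.
Qed.

End RealCocycle.

(** * From density of coboundaries to vanishing of the quotient *)

Section ReducedCohomologyVanishing.
Variables (R : realType) (K : zmodType) (nrm : K -> R) (G : groupType) (p : R).
Hypotheses (p_gt0 : 0 < p) (nrm_ge0 : forall a, 0 <= nrm a) (nrm0 : nrm 0 = 0)
  (nrmB : forall a b, nrm (a - b) <= nrm a + nrm b).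

Lemma cocycle0 : cocycles nrm p (0 : G -> G -> K).
Proof.
split=> [g|g h]; last by apply/funext => x; rewrite !fctE addr0.
apply/in_lpP => //; exists 0 => s _.
by rewrite big1// => x _; rewrite /= nrm0 normr0 powR0// gt_eqF.
Qed.

Lemma cocycleB (b c : G -> G -> K) :
  cocycles nrm p b -> cocycles nrm p c -> cocycles nrm p (b - c).
Proof.
move=> [b_lp bM] [c_lp cM]; split=> [g|g h]; last first.
  by apply/funext => x; rewrite !fctE bM cM !fctE opprD addrACA.
have /in_lpP[//|//|S bS] := b_lp g; have /in_lpP[//|//|S' cS'] := c_lp g.
apply/in_lpP => //; exists (2 `^ p * (S + S')).
apply: (psum_leD p_gt0 _ bS cS') => x /=; rewrite !ger0_norm//.
exact: nrmB.
Qed.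

Lemma cocycles_reduced_H1_eq0 :
  cocycles nrm p `<=` coboundaries_closure nrm (G := G) p ->
  reduced_H1_eq0 nrm G p.
Proof.
move=> sub_cl.
have clE : coboundaries_closure nrm (G := G) p = cocycles nrm p.
  by apply/seteqP; split => // b [].
have cosetE b : cocycles nrm (G := G) p b ->
    [set b + c | c in cocycles nrm p] = cocycles nrm p.
  move=> bZ; apply/seteqP; split => [_ [c cZ <-]|c cZ].
    (* The sum is written [b - (0 - c)] to use closure under differences alone. *)
    by rewrite -[c]opprK -[- c]sub0r; apply: cocycleB bZ (cocycleB cocycle0 cZ).
  by exists (c - b); [exact: cocycleB | rewrite addrC subrK].
rewrite /reduced_H1_eq0 /reduced_H1 clE; apply/seteqP; split => [_ [b bZ <-]|_ ->].
  by rewrite cosetE.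
by exists 0; [exact: cocycle0 | rewrite cosetE//; exact: cocycle0].
Qed.

End ReducedCohomologyVanishing.

(** * Normality and commutativity in the derived series *)

Section DerivedSeries.
Variable G : groupType.

Lemma is_subgroupP (A : set G) :
  is_subgroup A <-> A 1%g /\ forall x y, A x -> A y -> A (x * y^-1)%g.
Proof.
split=> [[A1 AB]|[A1 AB]]; split.
- exact: set_mem A1.
- by move=> x y Ax Ay; apply: set_mem (AB _ _ (mem_set Ax) (mem_set Ay)).
- exact: mem_set A1.
- move=> x y xA yA; apply: mem_set; apply: AB; [exact: set_mem xA | exact: set_mem yA].
Qed.

(** The preimage under conjugation by [g] of a subgroup [H] containing the commutators is again such
    a subgroup, so it contains the one they generate. *)
Lemma derived_series_conj n (g a : G) :
  derived_series G n a -> derived_series G n (g * a * g^-1)%g.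
Proof.
elim: n g a => [//|n IH] g a Da H [/is_subgroupP[H1 HB] HX].
suff : [set a | H (g * a * g^-1)%g] a by [].
apply: Da; split.
  apply/is_subgroupP; split=> [/=|x y Hx Hy /=]; first by rewrite mulg1 mulgV.
  by have := HB _ _ Hx Hy; rewrite !invgM invgK !mulgA mulgVK.
move=> _ [x Dx [y Dy <-]]; apply: HX.
exists (g * x * g^-1)%g; first exact: IH.
exists (g * y * g^-1)%g; first exact: IH.
have cjE z : (g * z * g^-1 = z ^ g^-1)%g by rewrite conjgE invgK mulgA.
by rewrite !cjE conjRg.
Qed.

Lemma last_derived_comm k : derived_series G k = [set 1%g] ->
  forall a b, derived_series G k.-1 a -> derived_series G k.-1 b ->
  (a * b = b * a)%g.
Proof.
(* As [0.-1 = 0], the case [k = 0] concerns the whole group, which is then trivial. *)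
case: k => [/= G1 a b _ _|k Dk1 a b Da Db].
  have G1E x : x = 1%g :> G by have : [set: G] x by []; rewrite G1.
  by rewrite (G1E a) (G1E b).
apply/commgP; apply/eqP.
have : derived_series G k.+1 (commg a b).
  by move=> H [_]; apply; exists a => //; exists b.
by rewrite Dk1.
Qed.

End DerivedSeries.

(** * The complex modulus against real and imaginary parts *)

Section ComplexNorm.
Variable R : realType.
Implicit Types z w : R[i].
Local Notation normc := (@ComplexField.Normc.normc R).

Lemma normc_ge0 z : 0 <= normc z.
Proof. by case: z => a b; exact: sqrtr_ge0. Qed.

Lemma normcB z w : normc (z - w) <= normc z + normc w.
Proof. by have := le_normcD z (- w : R[i]); rewrite normcN. Qed.

Lemma norm_Re_le z : `|complex.Re z| <= normc z.
Proof.
case: z => a b /=; rewrite -sqrtr_sqr ler_sqrt ?addr_ge0 ?sqr_ge0//.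
by rewrite lerDl sqr_ge0.
Qed.

Lemma norm_Im_le z : `|complex.Im z| <= normc z.
Proof.
case: z => a b /=; rewrite -sqrtr_sqr ler_sqrt ?addr_ge0 ?sqr_ge0//.
by rewrite lerDr sqr_ge0.
Qed.

Lemma normc_le z : normc z <= `|complex.Re z| + `|complex.Im z|.
Proof.
case: z => a b /=; rewrite -[leRHS]ger0_norm ?addr_ge0// -sqrtr_sqr ler_sqrt ?sqr_ge0//.
rewrite sqrrD !real_normK ?num_real// lerD2r lerDl.
by rewrite mulrn_wge0// mulr_ge0.
Qed.

End ComplexNorm.

Theorem corollary5p17 (R : realType) (G : groupType) (k d : nat)
    (G_fg : finitely_generated G)
    (G_solvable : solvable_of_length G k)
    (G_rank : rankZ_ge (derived_series G k.-1) d)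
    (p : R) (p_gt1 : 1 < p) (p_ltd : p < d%:R) :
  real_reduced_H1_eq0 G p /\ complex_reduced_H1_eq0 G p.
Proof.
have [beta [betaD beta_inj betaA]] := G_rank.
have p0 : 0 < p by exact: lt_trans p_gt1.
have approx := cocycle_approx betaD beta_inj betaA
  (last_derived_comm G_solvable.1) (derived_series_conj (n := k.-1)) p_gt1 p_ltd.
split.
  have norm_ge0 (a : R) : 0 <= `|a| by [].
  apply: cocycles_reduced_H1_eq0 => //; [exact: normr0 | exact: ler_normB | move=> b bZ].
  split=> // s e e0; have [b_lp bM] := bZ.
  have [g|g h x||xi [[S xiS] xi_s]] := approx b s ((e / 2) `^ p).
  - have /in_lpP[//|//|S bS] := b_lp g; exists S.
    by apply: ler_psum bS => // x /=; rewrite normr_id.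
  - by rewrite bM.
  - by apply/powR_gt0/divr_gt0.
  exists (fun g => left_regular g xi - xi).
    exists xi => //; apply/in_lpP => //; exists S.
    by apply: ler_psum xiS => // x /=; rewrite normr_id.
  move=> g gs; apply: lp_norm_lt => //.
  by apply: ler_psum (xi_s g gs) => // x /=; rewrite normr_id.
(* For complex scalars, the real and imaginary parts are real cocycles; they are approximated
   separately and recombined. *)
apply: cocycles_reduced_H1_eq0 => //; [exact: normc_ge0 | exact: ComplexField.Normc.normc0
  | exact: normcB | move=> b bZ].
split=> // s e e0; have [b_lp bM] := bZ.
(* Adding the two errors through [psum_leD] gives [2 ^ p * (e' + e')], which equals the
   [(e / 2) ^ p] required by [lp_norm_lt]. *)
pose e' := (e / 2) `^ p / 2 `^ p / 2.
have e'0 : 0 < e' by do 2 apply: divr_gt0 => //; apply/powR_gt0 => //; apply: divr_gt0.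
have [g|g h x|xi [[S xiS] xi_s]] := approx (fun g x => complex.Re (b g x)) s e' _ _ e'0.
- have /in_lpP[//|z|S bS] := b_lp g; first exact: normc_ge0.
  exists S; apply: ler_psum bS => // x /=.
  by rewrite [leRHS]ger0_norm ?normc_ge0// norm_Re_le.
- by rewrite bM raddfD.
have [g|g h x|eta [[S' etaS] eta_s]] := approx (fun g x => complex.Im (b g x)) s e' _ _ e'0.
- have /in_lpP[//|z|S' bS] := b_lp g; first exact: normc_ge0.
  exists S'; apply: ler_psum bS => // x /=.
  by rewrite [leRHS]ger0_norm ?normc_ge0// norm_Im_le.
- by rewrite bM raddfD.
pose zeta x := (xi x +i* eta x)%C.
exists (fun g => left_regular g zeta - zeta).
  exists zeta => //; apply/in_lpP => //; first exact: normc_ge0.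
  exists (2 `^ p * (S + S')); apply: (psum_leD p0 _ xiS etaS) => x.
  rewrite [leLHS]ger0_norm ?normc_ge0//; exact: normc_le.
move=> g gs; apply: lp_norm_lt => //; first exact: normc_ge0.
have -> : (e / 2) `^ p = 2 `^ p * (e' + e').
  by rewrite /e'; field; rewrite gt_eqF// powR_gt0.
apply: (psum_leD p0 _ (xi_s g gs) (eta_s g gs)) => x.
rewrite [leLHS]ger0_norm ?normc_ge0//; apply: le_trans (normc_le _) _.
by rewrite !fctE /zeta /left_regular; case: (b g x).
Qed.
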